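(* Let $\mathfrak{K}\in C^1([-1,1])$ be such that $\mathfrak{K}(1)\geq 0$. Then, for some $\delta>0$, the initial value problem $$ \left(\frac{u'(x)^2}{1+u'(x)^2}\right)'=2x\,\mathfrak{K}\!\left(\frac{1}{\sqrt{1+u'(x)^2}}\right)\ \text{ in } (0,\delta),\qquad u(0)=0,\quad u'(0)=0, $$ has a unique solution $u\in C^2([0,\delta])$ with $u\geq 0$.
   Context: Here $u=u(x)$ is a real function of one real variable and $'$ denotes $d/dx$. Geometrically, a solution $u$ yields a rotational graph $(x\cos\theta,x\sin\theta,u(x))$ in $\mathbb{R}^3$ that meets the $z$-axis orthogonally and whose Gauss curvature equals $\mathfrak{K}(\nu)$, where $\nu=1/\sqrt{1+u'^2}$ is its angle function (the inner product of the upwards unit normal with $e_3=(0,0,1)$). *)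

(* Defs.v *)
From Stdlib Require Import Reals.
Open Scope R_scope.

Definition Icc (a b x : R) : Prop := a <= x <= b.

(* f is of class C^k on D.  Derivatives and continuity are relative to D, hence
   one-sided at the endpoints of a compact interval; the values of f outside D
   play no role.  Meant for sets D without isolated points, where D_in
   determines the values of f' on D. *)
Fixpoint class_C (k : nat) (D : R -> Prop) (f : R -> R) : Prop :=
  match k with
  | O => forall x, D x -> continue_in f D x
  | S k' => exists f' : R -> R,
      (forall x, D x -> D_in f f' D x) /\ class_C k' D f'
  end.

(* u is a solution on [0, delta] of the initial value problem; du is u', which
   is one-sided at 0 and delta. *)
Definition solves_ivp (K : R -> R) (delta : R) (u : R -> R) : Prop :=
  exists du : R -> R,
    (forall x, Icc 0 delta x -> D_in u du (Icc 0 delta) x) /\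
    (forall x, 0 < x < delta ->
       derivable_pt_lim (fun t => du t ^ 2 / (1 + du t ^ 2)) x
         (2 * x * K (1 / sqrt (1 + du x ^ 2)))) /\
    u 0 = 0 /\ du 0 = 0.

Definition nonneg_C2_solution (K : R -> R) (delta : R) (u : R -> R) : Prop :=
  class_C 2 (Icc 0 delta) u /\
  (forall x, Icc 0 delta x -> 0 <= u x) /\
  solves_ivp K delta u.

(* Main.v *)
(** Put [w = u'^2 / (1 + u'^2)], so that the angle function is [nu = sqrt (1 - w)];
    in the variable [s = x^2] the equation becomes the autonomous [dw/ds = F w]
    with [F w = K (sqrt (1 - w))].  If [K 1 = 0], then [w = 0] is a solution.  If
    [K 1 > 0], then [F > 0] near 0 and the equation is solved by inverting
    [t |-> int_0^t 1/F]; moreover [w] is asymptotic to [K 1 * x^2], so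
    [u' = sqrt (w / (1 - w))] is C^1 up to [x = 0].  For uniqueness, [K] is
    Lipschitz, and since [w1 - w2 = (nu2 - nu1) (nu1 + nu2)] a lower bound on one of
    the two angle functions suffices for Gronwall's argument; this determines
    [u'^2].  When [u'] does not vanish on [(0, delta]], its sign is constant, and
    [u >= 0] makes it positive. *)

Require Import Defs.
From Stdlib Require Import Reals Lra.
From Coquelicot Require Import Coquelicot.
Open Scope R_scope.

(** * Extension from an interval to the line; relative and two-sided derivatives *)

(** The nearest-point projection onto [[a, b]]. The data are controlled only on an interval, whereas
    extreme values, intermediate values and integrals are applied to functions continuous on the
    line; precomposing with [clamp] provides such extensions. *)
Definition clamp (a b x : R) : R := Rmax a (Rmin b x).

Lemma clamp_Icc (a b x : R) : a <= b -> Icc a b (clamp a b x).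
Proof.
  intros Hab; unfold Icc, clamp.
  split; [apply Rmax_l | apply Rmax_lub; [exact Hab | apply Rmin_l]].
Qed.

Lemma clamp_id (a b x : R) : Icc a b x -> clamp a b x = x.
Proof.
  intros [H1 H2]; unfold clamp.
  rewrite (Rmin_right b x H2); exact (Rmax_right a x H1).
Qed.

Lemma clamp_nonexpansive (a b x y : R) :
  Rabs (clamp a b x - clamp a b y) <= Rabs (x - y).
Proof.
  unfold clamp, Rmax, Rmin; repeat destruct Rle_dec;
    unfold Rabs; repeat destruct Rcase_abs; lra.
Qed.

Lemma continuity_pt_clamp (f : R -> R) (a b : R) :
  a <= b -> (forall x, Icc a b x -> continue_in f (Icc a b) x) ->
  forall x, continuity_pt (fun t => f (clamp a b t)) x.
Proof.
  intros Hab Hf x eps Heps.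
  destruct (Hf (clamp a b x) (clamp_Icc a b x Hab) eps Heps) as [d [Hd Hlim]].
  exists d; split; [exact Hd | intros y [_ Hy]].
  destruct (Req_dec (clamp a b y) (clamp a b x)) as [E | E].
  - rewrite E; simpl; unfold Rdist; rewrite Rminus_diag, Rabs_R0; exact Heps.
  - apply Hlim; split.
    + split; [apply clamp_Icc, Hab | intros E'; apply E; symmetry; exact E'].
    + eapply Rle_lt_trans; [apply clamp_nonexpansive | exact Hy].
Qed.

Lemma continue_in_of_continuity_pt (f : R -> R) (D : R -> Prop) (x : R) :
  continuity_pt f x -> continue_in f D x.
Proof.
  intros Hf eps Heps; destruct (Hf eps Heps) as [d [Hd H]].
  exists d; split; [exact Hd | intros y [[_ Hy] Hxy]].
  apply H; split; [split; [exact I | exact Hy] | exact Hxy].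
Qed.

Lemma D_in_ext (f g f' g' : R -> R) (D : R -> Prop) (x : R) :
  D x -> (forall y, D y -> f y = g y) -> f' x = g' x ->
  D_in f f' D x -> D_in g g' D x.
Proof.
  intros Dx E E' Hf eps Heps; destruct (Hf eps Heps) as [d [Hd H]].
  exists d; split; [exact Hd | intros y [[Dy Hy] Hxy]].
  rewrite <- !E, <- E' by assumption; apply H; repeat split; assumption.
Qed.

Lemma D_in_of_derivable_pt_lim (f f' : R -> R) (D : R -> Prop) (x : R) :
  derivable_pt_lim f x (f' x) -> D_in f f' D x.
Proof.
  intros Hf eps Heps; destruct (Hf eps Heps) as [d H].
  exists d; split; [apply cond_pos | intros y [[_ Hy] Hxy]].
  specialize (H (y - x)); simpl in *; unfold Rdist in *.
  replace (x + (y - x)) with y in H by ring.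
  apply H; [lra | exact Hxy].
Qed.

Lemma derivable_pt_lim_of_D_in (f f' : R -> R) (a b x : R) :
  a < x < b -> D_in f f' (Icc a b) x -> derivable_pt_lim f x (f' x).
Proof.
  intros Hx Hf eps Heps; destruct (Hf eps Heps) as [d [Hd H]].
  assert (Hm : 0 < Rmin d (Rmin (x - a) (b - x)))
    by (repeat apply Rmin_pos; lra).
  exists (mkposreal _ Hm); simpl; intros h Hh0 Hh.
  pose proof (Rmin_l d (Rmin (x - a) (b - x))).
  pose proof (Rmin_r d (Rmin (x - a) (b - x))).
  pose proof (Rmin_l (x - a) (b - x)); pose proof (Rmin_r (x - a) (b - x)).
  apply Rabs_def2 in Hh as Hh'.
  specialize (H (x + h)); simpl in H; unfold Rdist in H.
  replace (x + h - x) with h in H by ring.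
  apply H; split; [split; [split |] |]; lra.
Qed.

(** Every point of a nondegenerate interval is a limit point of it, approached from the right except
    at [b]. This identifies the derivative coming from [class_C] with the one coming from
    [solves_ivp]. *)
Lemma D_in_Icc_unique (f f1 f2 : R -> R) (a b x : R) :
  a < b -> Icc a b x ->
  D_in f f1 (Icc a b) x -> D_in f f2 (Icc a b) x -> f1 x = f2 x.
Proof.
  intros Hab [Hx1 Hx2] H1 H2.
  refine (single_limit _ _ _ _ _ _ H1 H2).
  intros eps Heps.
  destruct (Rlt_le_dec x b) as [Hb | Hb].
  - exists (x + Rmin (b - x) (eps / 2)).
    assert (0 < Rmin (b - x) (eps / 2)) by (apply Rmin_pos; lra).
    pose proof (Rmin_l (b - x) (eps / 2)); pose proof (Rmin_r (b - x) (eps / 2)).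
    repeat split; try lra.
    simpl; unfold Rdist; rewrite Rabs_pos_eq; lra.
  - exists (x - Rmin (x - a) (eps / 2)).
    assert (0 < Rmin (x - a) (eps / 2)) by (apply Rmin_pos; lra).
    pose proof (Rmin_l (x - a) (eps / 2)); pose proof (Rmin_r (x - a) (eps / 2)).
    repeat split; try lra.
    simpl; unfold Rdist; rewrite Rabs_left; lra.
Qed.

Lemma derivable_pt_lim_locally_ext (f g : R -> R) (a b x l : R) :
  a < x < b -> (forall y, Icc a b y -> f y = g y) ->
  derivable_pt_lim f x l -> derivable_pt_lim g x l.
Proof.
  intros Hx E Hf.
  apply (derivable_pt_lim_of_D_in g (fun _ => l) a b x Hx).
  apply (D_in_ext f g (fun _ => l)); [split; lra | exact E | reflexivity |].
  apply D_in_of_derivable_pt_lim; exact Hf.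
Qed.

(** * Mean value theorem, Lipschitz bound and Gronwall inequality *)

Lemma mean_value (f f' : R -> R) (a b : R) :
  a < b -> (forall x, a <= x <= b -> continuity_pt f x) ->
  (forall x, a < x < b -> derivable_pt_lim f x (f' x)) ->
  exists c, a < c < b /\ f b - f a = f' c * (b - a).
Proof.
  intros Hab Hc Hd.
  destruct (MVT f id a b
    (fun c Hc' => exist _ (f' c) (Hd c Hc'))
    (fun c _ => exist _ 1 (derivable_pt_lim_id c)) Hab Hc
    (fun c _ => derivable_continuous_pt _ _ (derivable_pt_id c)))
    as [c [P E]].
  exists c; split; [exact P | unfold id in E; simpl in E; lra].
Qed.

(** The constant is the maximum of the absolute value of the derivative over the compact
    interval. *)
Lemma C1_Icc_lipschitz (a b : R) (K : R -> R) :
  a < b -> class_C 1 (Icc a b) K ->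
  exists L, 0 <= L /\ forall x y, Icc a b x -> Icc a b y ->
    Rabs (K x - K y) <= L * Rabs (x - y).
Proof.
  intros Hab [K' [HK HK']].
  assert (CK' := continuity_pt_clamp K' a b (Rlt_le _ _ Hab) HK').
  assert (CK : forall x, continuity_pt (fun t => K (clamp a b t)) x).
  { apply continuity_pt_clamp; [lra | intros x Hx].
    apply (cont_deriv K K'); apply HK, Hx. }
  destruct (continuity_ab_maj (fun t => Rabs (K' (clamp a b t))) a b) as [m [Hm _]].
  { lra. }
  { intros c _. apply (continuity_pt_comp (fun t => K' (clamp a b t)) Rabs).
    - apply CK'.
    - apply Rcontinuity_abs. }
  exists (Rabs (K' (clamp a b m))); split; [apply Rabs_pos |].
  assert (Main : forall x y, Icc a b x -> Icc a b y -> x < y ->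
    Rabs (K y - K x) <= Rabs (K' (clamp a b m)) * Rabs (y - x)).
  { intros x y Hx Hy Hxy.
    destruct (mean_value (fun t => K (clamp a b t)) K' x y Hxy) as [c [Pc E]].
    - intros z _; apply CK.
    - intros z Hz; unfold Icc in *.
      apply (derivable_pt_lim_locally_ext K _ a b); [lra | |].
      + intros t Ht; rewrite clamp_id; auto.
      + apply (derivable_pt_lim_of_D_in K K' a b); [lra |].
        apply HK; split; lra.
    - cbv beta in E; rewrite !clamp_id in E by assumption.
      rewrite E, Rabs_mult; apply Rmult_le_compat_r; [apply Rabs_pos |].
      unfold Icc in *; assert (Ic : a <= c <= b) by lra.
      specialize (Hm c Ic); cbv beta in Hm.
      rewrite (clamp_id a b c Ic) in Hm; exact Hm. }
  intros x y Hx Hy; destruct (Rtotal_order x y) as [H | [H | H]].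
  - rewrite (Rabs_minus_sym (K x)), (Rabs_minus_sym x); auto.
  - subst; rewrite !Rminus_diag, Rabs_R0; lra.
  - auto.
Qed.

(** The product [f t * exp (- C * t)] starts at 0 and has nonpositive derivative. *)
Lemma gronwall_zero (f f' : R -> R) (C d : R) :
  (forall x, continuity_pt f x) ->
  (forall x, 0 < x < d -> derivable_pt_lim f x (f' x)) ->
  (forall x, 0 < x < d -> f' x <= C * f x) ->
  f 0 = 0 -> forall x, Icc 0 d x -> f x <= 0.
Proof.
  intros Hc Hd Hle H0 x [Hx0 Hxd].
  destruct Hx0 as [Hx0 | <-]; [| lra].
  destruct (mean_value (fun t => f t * exp (- C * t))
    (fun t => f' t * exp (- C * t) + f t * (exp (- C * t) * - C)) 0 x Hx0)
    as [c [Pc E]].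
  - intros t _; apply continuity_pt_mult; [apply Hc |].
    apply derivable_continuous_pt; exists (exp (- C * t) * - C).
    apply is_derive_Reals; auto_derive; [exact I | ring].
  - intros t Ht; apply (derivable_pt_lim_mult f (fun t => exp (- C * t)));
      [apply Hd; lra |].
    apply is_derive_Reals; auto_derive; [exact I | ring].
  - specialize (Hle c ltac:(lra)).
    rewrite H0 in E.
    pose proof (exp_pos (- C * c)); pose proof (exp_pos (- C * x)).
    assert (f' c * exp (- C * c) + f c * (exp (- C * c) * - C) <= 0) by nra.
    assert (f x * exp (- C * x) <= 0) by nra.
    nra.
Qed.

(** * An autonomous equation with right-hand side bounded away from zero *)

(* [H] is the inverse of [t |-> int_0^t 1/F]. *)
Lemma autonomous_ode (F : R -> R) (c M : R) :
  0 < c -> (forall x, continuity_pt F x) -> (forall x, c <= F x <= M) ->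
  exists H : R -> R, H 0 = 0 /\ forall s, derivable_pt_lim H s (F (H s)).
Proof.
  intros Hc CF HF.
  set (G := fun t => RInt (fun y => / F y) 0 t).
  assert (CiF : forall x, continuous (fun y => / F y) x).
  { intros x; apply continuity_pt_filterlim, continuity_pt_inv; [apply CF |].
    specialize (HF x); lra. }
  assert (DG : forall x, derivable_pt_lim G x (/ F x)).
  { intros x; apply is_derive_Reals.
    apply (is_derive_RInt (fun y => / F y) G 0 x).
    - apply filter_forall; intros y; apply (@RInt_correct R_CompleteNormedModule).
      apply (@ex_RInt_continuous R_CompleteNormedModule); intros z _; apply CiF.
    - apply CiF. }
  assert (CG : forall x, continuity_pt G x).
  { intros x; apply derivable_continuous_pt; exists (/ F x); apply DG. }
  (* The mean value theorem for [G], solved for the increment of the argument and free of any order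
     between [a] and [b]. It yields surjectivity of [G], the value [H 0 = 0] and the derivative of
     the inverse. *)
  assert (MV : forall a b, exists xi, Rmin a b <= xi <= Rmax a b /\
     b - a = F xi * (G b - G a)).
  { intros a b; destruct (MVT_gen G a b (fun t => / F t)) as [xi [P E]].
    - intros x _; apply is_derive_Reals, DG.
    - intros x _; apply CG.
    - exists xi; split; [exact P |]. rewrite E; field; specialize (HF xi); lra. }
  assert (HM : 0 < M) by (specialize (HF 0); lra).
  assert (G0 : G 0 = 0) by exact (RInt_point 0 _).
  (* Since [G' >= 1 / M], the value [s] is attained between [- (M * Rabs s)] and [M * Rabs s]. *)
  assert (Sur : forall s, {t | G t = s}).
  { intros s.
    destruct (IVT_gen G (- (M * Rabs s)) (M * Rabs s) s) as [t [_ Ht]].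
    - intros x; apply CG.
    - destruct (MV (- (M * Rabs s)) 0) as [x1 [_ E1]].
      destruct (MV 0 (M * Rabs s)) as [x2 [_ E2]].
      rewrite G0 in E1, E2.
      pose proof (HF x1); pose proof (HF x2).
      assert (- Rabs s >= G (- (M * Rabs s))).
      { pose proof (Rabs_pos s). apply Rle_ge, Rnot_lt_le; intros Hn.
        assert (F x1 * (0 - G (- (M * Rabs s))) < M * Rabs s) by nra. lra. }
      assert (Rabs s <= G (M * Rabs s)).
      { pose proof (Rabs_pos s). apply Rnot_lt_le; intros Hn.
        assert (F x2 * (G (M * Rabs s) - 0) < M * Rabs s) by nra. lra. }
      pose proof (Rle_abs s); pose proof (Rle_abs (- s)).
      rewrite Rabs_Ropp in *.
      pose proof (Rmin_l (G (- (M * Rabs s))) (G (M * Rabs s))).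
      pose proof (Rmax_r (G (- (M * Rabs s))) (G (M * Rabs s))).
      lra.
    - exists t; exact Ht. }
  set (H := fun s => proj1_sig (Sur s)).
  assert (GH : forall s, G (H s) = s) by (intros s; exact (proj2_sig (Sur s))).
  exists H; split.
  - destruct (MV 0 (H 0)) as [xi [_ E]].
    rewrite GH, G0 in E; lra.
  - intros s eps Heps.
    destruct (CF (H s) eps Heps) as [eta [Heta Hlim]].
    (* By [MV] the difference quotient of [H] is exactly [F xi] with [xi] between [H s] and
       [H (s + h)]. As [H] is [M]-Lipschitz, an increment below [eta / M] keeps [xi] within [eta] of
       [H s]. *)
    assert (Hd : 0 < eta / M) by (apply Rdiv_lt_0_compat; lra).
    exists (mkposreal _ Hd); simpl; intros h Hh0 Hh.
    destruct (MV (H s) (H (s + h))) as [xi [Pxi E]].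
    rewrite !GH in E; replace (s + h - s) with h in E by ring.
    rewrite E; replace (F xi * h / h) with (F xi) by (field; exact Hh0).
    assert (Hxi : Rabs (xi - H s) < eta).
    { apply Rle_lt_trans with (Rabs (H (s + h) - H s)).
      - revert Pxi; unfold Rmin, Rmax, Rabs.
        repeat destruct Rle_dec; repeat destruct Rcase_abs; lra.
      - rewrite E, Rabs_mult, Rabs_pos_eq by (specialize (HF xi); lra).
        apply Rle_lt_trans with (M * Rabs h).
        + apply Rmult_le_compat_r; [apply Rabs_pos | apply HF].
        + replace eta with (M * (eta / M)) by (field; lra).
          apply Rmult_lt_compat_l; lra. }
    destruct (Req_dec xi (H s)) as [-> | Hne].
    + rewrite Rminus_diag, Rabs_R0; exact Heps.
    + apply Hlim; split; [split; [exact I | auto] | exact Hxi].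
Qed.

(** * Construction of the slope when [K 1 > 0] *)

Lemma angle_of_slope_sqr (q w : R) :
  w < 1 -> q ^ 2 = w / (1 - w) ->
  q ^ 2 / (1 + q ^ 2) = w /\ 1 / sqrt (1 + q ^ 2) = sqrt (1 - w).
Proof.
  intros Hw E; rewrite E.
  replace (1 + w / (1 - w)) with (/ (1 - w)) by (field; lra).
  split; [field; lra |].
  rewrite sqrt_inv; unfold Rdiv; rewrite Rmult_1_l; apply Rinv_inv.
Qed.

Lemma derivable_pt_lim_sqrt_odds (w : R -> R) (x l : R) :
  0 < w x < 1 -> derivable_pt_lim w x l ->
  derivable_pt_lim (fun t => sqrt (w t / (1 - w t))) x
    (l / (1 - w x) ^ 2 / (2 * sqrt (w x / (1 - w x)))).
Proof.
  intros Hw Dw; apply is_derive_Reals in Dw.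
  assert (P : 0 < w x / (1 - w x)) by (apply Rdiv_lt_0_compat; lra).
  assert (S := sqrt_lt_R0 _ P).
  apply is_derive_Reals; auto_derive.
  - repeat split; [exists l; exact Dw | exists l; exact Dw | lra | exact P].
  - replace (Derive (fun t => w t) x) with l by (symmetry; apply is_derive_unique, Dw).
    change (w x * / (1 + - w x)) with (w x / (1 - w x)).
    field; lra.
Qed.

Lemma positive_slope_exists (K : R -> R) (L : R) :
  0 <= L ->
  (forall x y, Icc (-1) 1 x -> Icc (-1) 1 y ->
     Rabs (K x - K y) <= L * Rabs (x - y)) ->
  0 < K 1 ->
  exists (delta : R) (q q' : R -> R),
    0 < delta /\ q 0 = 0 /\ (forall x, 0 < x <= delta -> 0 < q x) /\
    (forall x, Icc 0 delta x -> D_in q q' (Icc 0 delta) x) /\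
    (forall x, Icc 0 delta x -> continue_in q' (Icc 0 delta) x) /\
    (forall x, 0 < x < delta ->
       derivable_pt_lim (fun t => q t ^ 2 / (1 + q t ^ 2)) x
         (2 * x * K (1 / sqrt (1 + q x ^ 2)))).
Proof.
  intros HL0 HL HK.
  (* Within [e] of 1, [K] differs from [K 1] by at most [L * e <= K 1 / 2], hence stays above
     [K 1 / 2]. The bound [1 / 2] keeps [m = 1 - e] positive, and [L + 1] avoids dividing by zero
     when [L = 0]. *)
  set (e := Rmin (1 / 2) (K 1 / (2 * (L + 1)))).
  assert (He : 0 < e) by (apply Rmin_pos; [lra | apply Rdiv_lt_0_compat; lra]).
  assert (He2 : e <= 1 / 2) by apply Rmin_l.
  assert (HeL : L * e <= K 1 / 2).
  { assert (e <= K 1 / (2 * (L + 1))) by apply Rmin_r.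
    assert (e * (L + 1) <= K 1 / 2); [| nra].
    replace (K 1 / 2) with (K 1 / (2 * (L + 1)) * (L + 1)) by (field; lra).
    apply Rmult_le_compat_r; lra. }
  set (m := 1 - e).
  assert (Hm : 1 / 2 <= m < 1) by (unfold m; lra).
  (* The clamping makes [F] globally defined and positive; it is inactive for the
     small [w] that matter. *)
  set (F := fun w => K (clamp m 1 (sqrt (1 - w)))).
  assert (CF : forall w, continuity_pt F w).
  { intros w; apply (continuity_pt_comp (fun w => sqrt (1 - w)) (fun y => K (clamp m 1 y))).
    - apply continuity_pt_filterlim.
      apply (continuous_comp (fun w => 1 - w) sqrt); [| apply continuous_sqrt].
      apply (@continuous_minus R_UniformSpace R_AbsRing R_NormedModule);
        [apply continuous_const | apply continuous_id].
    - apply (continuity_pt_clamp K m 1); [lra |].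
      intros x Hx eps Heps; exists (eps / (L + 1)).
      split; [apply Rdiv_lt_0_compat; lra | intros y [[Hy _] Hxy]].
      simpl in *; unfold Rdist in *; unfold Icc in *.
      apply Rle_lt_trans with (L * Rabs (y - x)).
      + apply HL; unfold Icc; lra.
      + apply Rle_lt_trans with (L * (eps / (L + 1))).
        * apply Rmult_le_compat_l; lra.
        * apply Rlt_le_trans with ((L + 1) * (eps / (L + 1))).
          -- apply Rmult_lt_compat_r; [apply Rdiv_lt_0_compat |]; lra.
          -- right; field; lra. }
  assert (HF : forall w, K 1 / 2 <= F w <= 2 * K 1).
  { intros w; unfold F; destruct (clamp_Icc m 1 (sqrt (1 - w))) as [I1 I2]; [lra |].
    set (y := clamp m 1 (sqrt (1 - w))) in *.
    assert (Hy : Rabs (K y - K 1) <= L * Rabs (y - 1)) by (apply HL; unfold Icc; lra).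
    rewrite (Rabs_left1 (y - 1)) in Hy by lra.
    assert (L * - (y - 1) <= L * e) by (apply Rmult_le_compat_l; unfold m in *; lra).
    revert Hy; unfold Rabs; destruct Rcase_abs; lra. }
  destruct (autonomous_ode F (K 1 / 2) (2 * K 1)) as [H [H0 DH]];
    [lra | exact CF | exact HF |].
  assert (CH : forall s, continuity_pt H s).
  { intros s; apply derivable_continuous_pt; exists (F (H s)); apply DH. }
  assert (HB : forall s, 0 <= s -> K 1 / 2 * s <= H s <= 2 * K 1 * s).
  { intros s [Hs | <-]; [| lra].
    destruct (mean_value H (fun t => F (H t)) 0 s Hs) as [c [_ E]]; auto.
    specialize (HF (H c)); rewrite H0 in E; nra. }
  (* [rho s = H s / s], extended continuously by [H' 0], so that [u' x = x * r x]
     below is visibly differentiable at 0 even though [u'] is a square root. *)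
  set (rho := fun s => if Req_dec_T s 0 then F 0 else H s / s).
  assert (Crho : forall s, continuity_pt rho s).
  { intros s; destruct (Req_dec s 0) as [-> | Hs].
    - intros eps Heps; destruct (DH 0 eps Heps) as [d Hd].
      exists d; split; [apply cond_pos | intros y [[_ Hy] Hy']].
      simpl in *; unfold Rdist in *; unfold rho.
      destruct (Req_dec_T y 0); [lra |]; destruct (Req_dec_T 0 0); [| lra].
      rewrite Rminus_0_r in Hy'; specialize (Hd y n Hy').
      rewrite H0, Rplus_0_l, Rminus_0_r in Hd; exact Hd.
    - assert (Hp : 0 < Rabs s) by (apply Rabs_pos_lt, Hs).
      apply (continuity_pt_ext_loc (fun s => H s / s)).
      + exists (mkposreal _ Hp); intros y Hy.
        unfold rho; destruct (Req_dec_T y 0) as [-> |]; [| reflexivity].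
        revert Hy; unfold ball; simpl; unfold AbsRing_ball, abs, minus, plus, opp; simpl.
        rewrite Rplus_0_l, Rabs_Ropp; lra.
      + apply continuity_pt_div; [apply CH | apply continuity_pt_id | exact Hs]. }
  assert (Hrho : forall s, 0 <= s -> 0 < rho s).
  { intros s Hs; unfold rho; destruct (Req_dec_T s 0).
    - specialize (HF 0); lra.
    - apply Rdiv_lt_0_compat; [| lra].
      specialize (HB s Hs); nra. }
  (* Since [w x <= 2 * K 1 * x ^ 2], the two entries of the minimum ensure [w <= 1 - m ^ 2] on
     [[0, 2 * d]], that is [sqrt (1 - w) >= m], where the clamping is inactive. The halving makes
     [d] an interior point of [[0, 2 * d]], so that two-sided derivatives are available there. *)
  set (d := Rmin 1 ((1 - m ^ 2) / (2 * K 1)) / 2).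
  assert (Hd : 0 < d).
  { unfold d; apply Rdiv_lt_0_compat; [apply Rmin_pos |]; try lra.
    apply Rdiv_lt_0_compat; nra. }
  assert (Hd1 : 2 * d <= 1).
  { pose proof (Rmin_l 1 ((1 - m ^ 2) / (2 * K 1))); unfold d; lra. }
  assert (Hd2 : 2 * K 1 * (2 * d) <= 1 - m ^ 2).
  { pose proof (Rmin_r 1 ((1 - m ^ 2) / (2 * K 1))).
    replace (1 - m ^ 2) with (2 * K 1 * ((1 - m ^ 2) / (2 * K 1))) by (field; lra).
    apply Rmult_le_compat_l; unfold d; lra. }
  set (w := fun x => H (x ^ 2)).
  assert (Hw : forall x, Icc 0 (2 * d) x -> 0 <= w x <= 1 - m ^ 2).
  { intros x [Hx1 Hx2]; unfold w.
    specialize (HB (x ^ 2) (pow2_ge_0 x)).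
    assert (x ^ 2 <= 2 * d) by nra.
    pose proof (pow2_ge_0 x); nra. }
  assert (Hw1 : forall x, Icc 0 (2 * d) x -> w x < 1).
  { intros x Hx; specialize (Hw x Hx); nra. }
  assert (Hpos : forall x, Icc 0 (2 * d) x -> 0 < rho (x ^ 2) / (1 - w x)).
  { intros x Hx; specialize (Hw1 x Hx).
    apply Rdiv_lt_0_compat; [apply Hrho, pow2_ge_0 | lra]. }
  set (r := fun x => sqrt (rho (x ^ 2) / (1 - w x))).
  set (q := fun x => x * r x).
  assert (Hr : forall x, Icc 0 (2 * d) x -> 0 < r x)
    by (intros x Hx; apply sqrt_lt_R0, Hpos, Hx).
  assert (Cw : forall x, continuity_pt w x).
  { intros x; apply (continuity_pt_comp (fun x => x ^ 2) H); [| apply CH].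
    apply derivable_continuous_pt, derivable_pt_pow. }
  assert (Dw : forall x, derivable_pt_lim w x (F (w x) * (2 * x))).
  { intros x; apply (derivable_pt_lim_comp (fun x => x ^ 2) H); [| apply DH].
    apply is_derive_Reals; auto_derive; [exact I | ring]. }
  assert (Cr : forall x, Icc 0 (2 * d) x -> continuity_pt r x).
  { intros x Hx; specialize (Hw1 x Hx).
    apply (continuity_pt_comp (fun x => rho (x ^ 2) / (1 - w x)) sqrt);
      [| apply continuity_pt_sqrt, Rlt_le, Hpos, Hx].
    apply continuity_pt_div; [| | lra].
    - apply (continuity_pt_comp (fun x => x ^ 2) rho); [| apply Crho].
      apply derivable_continuous_pt, derivable_pt_pow.
    - apply continuity_pt_minus; [apply continuity_pt_const; intros ? ?; reflexivity | apply Cw]. }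
  assert (Hq2 : forall x, Icc 0 (2 * d) x -> q x ^ 2 = w x / (1 - w x)).
  { intros x Hx; unfold q, r; rewrite Rpow_mult_distr, pow2_sqrt by (apply Rlt_le, Hpos, Hx).
    specialize (Hw1 x Hx); unfold rho, w in *.
    destruct (Req_dec_T (x ^ 2) 0) as [E | E].
    - rewrite E, H0; field.
    - field; split; [lra |]; intros ->; apply E; ring. }
  (* For [x > 0] the derivative of [sqrt (w / (1 - w))] is [F w * 2 x / (1 - w) ^ 2 / (2 q)]. With
     [q = x * r x] the factor [x] cancels, leaving an expression continuous at 0. *)
  exists d, q, (fun x => F (w x) / (1 - w x) ^ 2 / r x).
  split; [exact Hd |]; split; [unfold q; ring |]; split.
  { intros x Hx; apply Rmult_lt_0_compat; [lra | apply Hr; unfold Icc; lra]. }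
  split; [| split].
  - intros x Hx; destruct (Req_dec x 0) as [-> | Hx0].
    (* At 0 the difference quotient of [q] is [r] itself, so the derivative is [r 0]. It agrees with
       the proposed formula because [w 0 = 0] and [r 0 * r 0 = F 0]. *)
    + apply (limit1_ext r).
      * intros y [_ Hy]; unfold q; field; auto.
      * assert (E : F (w 0) / (1 - w 0) ^ 2 / r 0 = r 0).
        { assert (P : 0 < r 0) by (apply Hr; unfold Icc; lra).
          assert (E : r 0 * r 0 = F 0).
          { unfold r; rewrite sqrt_sqrt by (apply Rlt_le, Hpos; unfold Icc; lra).
            unfold w, rho; rewrite pow_i, H0 by auto.
            destruct (Req_dec_T 0 0); [field | lra]. }
          unfold w; rewrite pow_i, H0 by auto; rewrite <- E; field; lra. }
        rewrite E; apply (continue_in_of_continuity_pt r); apply Cr; unfold Icc; lra.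
    + apply D_in_of_derivable_pt_lim; unfold Icc in *.
      apply (derivable_pt_lim_locally_ext (fun t => sqrt (w t / (1 - w t))) q 0 (2 * d));
        [lra | |].
      * intros y Hy; rewrite <- Hq2 by exact Hy; apply sqrt_pow2.
        apply Rmult_le_pos; [apply Hy | apply Rlt_le, Hr, Hy].
      * assert (Hx' : Icc 0 (2 * d) x) by (unfold Icc; lra).
        specialize (Hw1 x Hx'); specialize (Hr x Hx').
        assert (Wpos : 0 < w x).
        { unfold w; specialize (HB (x ^ 2) (pow2_ge_0 x)).
          assert (0 < x ^ 2) by (apply pow_lt; lra). nra. }
        assert (Eq : sqrt (w x / (1 - w x)) = x * r x).
        { rewrite <- Hq2 by exact Hx'; apply sqrt_pow2.
          unfold q; nra. }
        replace (F (w x) / (1 - w x) ^ 2 / r x)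
          with (F (w x) * (2 * x) / (1 - w x) ^ 2 / (2 * sqrt (w x / (1 - w x))))
          by (rewrite Eq; field; lra).
        apply derivable_pt_lim_sqrt_odds; [lra | apply Dw].
  - intros x Hx; apply continue_in_of_continuity_pt.
    assert (Hx' : Icc 0 (2 * d) x) by (unfold Icc in *; lra).
    specialize (Hw1 x Hx'); specialize (Hr x Hx').
    apply continuity_pt_div; [| apply Cr, Hx' | lra].
    apply continuity_pt_div; [| | apply pow_nonzero; lra].
    + apply (continuity_pt_comp w F); auto.
    + apply (continuity_pt_comp w (fun y => (1 - y) ^ 2)); [apply Cw |].
      apply derivable_continuous_pt; exists (- 2 * (1 - w x)).
      apply is_derive_Reals; auto_derive; [exact I | ring].
  - intros x Hx.
    assert (Hx' : Icc 0 (2 * d) x) by (unfold Icc in *; lra).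
    apply (derivable_pt_lim_locally_ext w _ 0 (2 * d)); [lra | |].
    + intros y Hy; symmetry; apply angle_of_slope_sqr; auto.
    + rewrite (proj2 (angle_of_slope_sqr (q x) (w x) (Hw1 x Hx') (Hq2 x Hx'))).
      replace (K (sqrt (1 - w x))) with (F (w x)).
      * replace (2 * x * F (w x)) with (F (w x) * (2 * x)) by ring.
        apply Dw.
      * unfold F; rewrite clamp_id; [reflexivity |].
        specialize (Hw x Hx'); split.
        -- rewrite <- (sqrt_pow2 m) by lra; apply sqrt_le_1_alt; lra.
        -- rewrite <- sqrt_1 at 2; apply sqrt_le_1_alt; lra.
Qed.

(** * Uniqueness of the squared slope and determination of its sign *)

(** Gronwall's inequality is applied to the square of [W (q1 x) - W (q2 x)]. The right-hand side is
    Lipschitz in the angle function but, as a function of [w], may fail to be so near [w = 1], where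
    the angle function vanishes; this is why a positive lower bound is sought. *)
Lemma slope_sqr_unique (K q1 q2 : R -> R) (L delta : R) :
  0 <= L ->
  (forall x y, Icc (-1) 1 x -> Icc (-1) 1 y ->
     Rabs (K x - K y) <= L * Rabs (x - y)) ->
  0 < delta ->
  (forall x, continuity_pt q1 x) -> (forall x, continuity_pt q2 x) ->
  q1 0 = 0 -> q2 0 = 0 ->
  (forall x, 0 < x < delta ->
     derivable_pt_lim (fun t => q1 t ^ 2 / (1 + q1 t ^ 2)) x
       (2 * x * K (1 / sqrt (1 + q1 x ^ 2)))) ->
  (forall x, 0 < x < delta ->
     derivable_pt_lim (fun t => q2 t ^ 2 / (1 + q2 t ^ 2)) x
       (2 * x * K (1 / sqrt (1 + q2 x ^ 2)))) ->
  forall x, Icc 0 delta x -> q1 x ^ 2 = q2 x ^ 2.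
Proof.
  intros HL0 HL Hd C1 C2 Z1 Z2 D1 D2.
  set (nu := fun y => 1 / sqrt (1 + y ^ 2)).
  set (W := fun y => y ^ 2 / (1 + y ^ 2)).
  assert (S : forall y, 1 <= sqrt (1 + y ^ 2)).
  { intros y; rewrite <- sqrt_1 at 1; apply sqrt_le_1_alt.
    pose proof (pow2_ge_0 y); lra. }
  assert (Hnu : forall y, 0 < nu y <= 1).
  { intros y; unfold nu; specialize (S y); split; [apply Rdiv_lt_0_compat; lra |].
    apply Rmult_le_reg_r with (sqrt (1 + y ^ 2)); [lra |].
    field_simplify; lra. }
  assert (HW : forall y, W y = 1 - nu y ^ 2).
  { intros y; unfold W, nu; specialize (S y); pose proof (pow2_ge_0 y).
    replace ((1 / sqrt (1 + y ^ 2)) ^ 2) with (/ sqrt (1 + y ^ 2) ^ 2) by (field; lra).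
    rewrite pow2_sqrt by lra; field; lra. }
  assert (CP : forall y, continuity_pt (fun t => 1 + t ^ 2) y) by (intros y; reg).
  assert (Cnu : forall y, continuity_pt nu y).
  { intros y; apply continuity_pt_div.
    - apply continuity_pt_const; intros ? ?; reflexivity.
    - apply (continuity_pt_comp (fun t => 1 + t ^ 2) sqrt); [apply CP |].
      apply continuity_pt_sqrt; pose proof (pow2_ge_0 y); lra.
    - specialize (S y); lra. }
  assert (CW : forall y, continuity_pt W y).
  { intros y; apply continuity_pt_div; [reg | apply CP |].
    pose proof (pow2_ge_0 y); lra. }
  (* Compactness gives the positive lower bound [mu] for the first angle function; it also bounds
     the sum of the two from below. *)
  destruct (continuity_ab_min (fun t => nu (q1 t)) 0 delta) as [p [Hp _]]; [lra | |].
  { intros c _; apply (continuity_pt_comp q1 nu); auto. }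
  set (mu := nu (q1 p)) in *; cbv beta in Hp.
  assert (Hmu : 0 < mu) by apply Hnu.
  set (D := fun x => (W (q1 x) - W (q2 x)) ^ 2).
  assert (HD : forall x, Icc 0 delta x -> D x <= 0).
  { apply (gronwall_zero D
      (fun x => 2 * (W (q1 x) - W (q2 x)) *
         (2 * x * K (nu (q1 x)) - 2 * x * K (nu (q2 x))))
      (* With [a] and [b] the two angle functions, the derivative is at most
         [4 x L (a - b)^2 (a + b)], while the function is [(a - b)^2 (a + b)^2]. The constant
         follows from [x <= delta] and [a + b >= mu]. *)
      (4 * delta * L / mu)).
    - intros x; unfold D.
      apply (continuity_pt_comp (fun x => W (q1 x) - W (q2 x)) (fun y => y ^ 2)).
      + apply continuity_pt_minus;
          [apply (continuity_pt_comp q1 W) | apply (continuity_pt_comp q2 W)]; auto.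
      + apply derivable_continuous_pt, derivable_pt_pow.
    - intros x Hx; unfold D.
      replace (2 * (W (q1 x) - W (q2 x)) * (2 * x * K (nu (q1 x)) - 2 * x * K (nu (q2 x))))
        with (INR 2 * (W (q1 x) - W (q2 x)) ^ Nat.pred 2 *
               (2 * x * K (nu (q1 x)) - 2 * x * K (nu (q2 x)))) by (simpl; ring).
      apply (derivable_pt_lim_comp (fun x => W (q1 x) - W (q2 x)) (fun y => y ^ 2)).
      + apply derivable_pt_lim_minus; [apply D1 | apply D2]; exact Hx.
      + apply derivable_pt_lim_pow.
    - intros x Hx; unfold D.
      assert (I1 := Hnu (q1 x)); assert (I2 := Hnu (q2 x)).
      assert (Hpx : mu <= nu (q1 x)) by (apply Hp; lra).
      assert (LK := HL (nu (q1 x)) (nu (q2 x)) ltac:(unfold Icc; lra) ltac:(unfold Icc; lra)).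
      rewrite !HW; set (a := nu (q1 x)) in *; set (b := nu (q2 x)) in *.
      replace (1 - a ^ 2 - (1 - b ^ 2)) with ((b - a) * (a + b)) by ring.
      apply Rle_trans with (4 * x * (L * (a - b) ^ 2) * (a + b)).
      + apply Rle_trans with (4 * x * (Rabs (b - a) * Rabs (K a - K b)) * (a + b)).
        * rewrite <- Rabs_mult.
          assert (P := Rle_abs ((b - a) * (K a - K b))).
          assert (0 <= 4 * x * (a + b)) by nra. nra.
        * apply Rmult_le_compat_r; [lra |]; apply Rmult_le_compat_l; [lra |].
          rewrite Rabs_minus_sym, <- pow2_abs; pose proof (Rabs_pos (a - b)); nra.
      + replace (4 * delta * L / mu * ((b - a) * (a + b)) ^ 2)
          with (4 * (L * (a - b) ^ 2) * (a + b) * (delta * ((a + b) / mu))) by (field; lra).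
        replace (4 * x * (L * (a - b) ^ 2) * (a + b))
          with (4 * (L * (a - b) ^ 2) * (a + b) * x) by ring.
        apply Rmult_le_compat_l.
        * pose proof (pow2_ge_0 (a - b)).
          apply Rmult_le_pos; [| lra]; apply Rmult_le_pos; [lra |]; nra.
        * assert (1 <= (a + b) / mu).
          { apply Rmult_le_reg_r with mu; [lra |].
            unfold Rdiv; rewrite Rmult_assoc, Rinv_l; lra. }
          nra.
    - unfold D; rewrite Z1, Z2; ring. }
  intros x Hx; specialize (HD x Hx); unfold D in HD.
  assert (E : W (q1 x) = W (q2 x)) by nra.
  unfold W in E; pose proof (pow2_ge_0 (q1 x)); pose proof (pow2_ge_0 (q2 x)).
  apply (f_equal (fun z => z * ((1 + q1 x ^ 2) * (1 + q2 x ^ 2)))) in E.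
  field_simplify in E; nra.
Qed.

(** If [q x < 0], then [v x >= 0 = v 0] and the mean value theorem give an earlier point with
    [q >= 0], so [q] vanishes somewhere in between or at that point. *)
Lemma slope_nonneg (v q : R -> R) (delta : R) :
  (forall x, continuity_pt q x) ->
  (forall x, continuity_pt v x) ->
  (forall x, 0 < x < delta -> derivable_pt_lim v x (q x)) ->
  v 0 = 0 -> (forall x, Icc 0 delta x -> 0 <= v x) ->
  (forall x, 0 < x <= delta -> q x <> 0) ->
  forall x, 0 < x <= delta -> 0 < q x.
Proof.
  intros Cq Cv Dv v0 Hv Hq x Hx.
  destruct (Rtotal_order (q x) 0) as [Hn | [E | Hp]]; [exfalso | exfalso; exact (Hq x Hx E) | exact Hp].
  destruct (mean_value v q 0 x) as [c [Pc E]]; [lra | intros; apply Cv | intros; apply Dv; lra |].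
  rewrite v0 in E; specialize (Hv x ltac:(unfold Icc; lra)).
  assert (Hc : 0 <= q c) by nra.
  destruct Hc as [Hc | Hc]; [| apply (Hq c); lra].
  destruct (IVT (fun t => - q t) c x) as [z [Pz Ez]]; try lra.
  - intros t; apply continuity_pt_opp, Cq.
  - apply (Hq z); lra.
Qed.

(** The derivative from [class_C] is continuous and the one from [solves_ivp] satisfies the
    equation. They agree on [[0, delta]], so one globally continuous [q] carries both properties. *)
Lemma solution_slope (K : R -> R) (delta : R) (v : R -> R) :
  0 < delta -> nonneg_C2_solution K delta v ->
  exists q : R -> R,
    (forall x, continuity_pt q x) /\ q 0 = 0 /\
    (forall x, 0 < x < delta -> derivable_pt_lim (fun t => v (clamp 0 delta t)) x (q x)) /\
    (forall x, 0 < x < delta ->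
       derivable_pt_lim (fun t => q t ^ 2 / (1 + q t ^ 2)) x
         (2 * x * K (1 / sqrt (1 + q x ^ 2)))).
Proof.
  intros Hd [[v' [Dv [v'' [Dv' _]]]] [_ [dv [Ddv [Eq [_ dv0]]]]]].
  assert (E : forall x, Icc 0 delta x -> v' x = dv x).
  { intros x Hx; apply (D_in_Icc_unique v v' dv 0 delta x); auto. }
  assert (E' : forall x, Icc 0 delta x -> dv x = v' (clamp 0 delta x)).
  { intros x Hx; rewrite clamp_id; [symmetry |]; auto. }
  exists (fun x => v' (clamp 0 delta x)); split; [| split; [| split]].
  - apply continuity_pt_clamp; [lra |].
    intros x Hx; apply (cont_deriv v' v''), Dv', Hx.
  - rewrite <- E'; [exact dv0 | unfold Icc; lra].
  - intros x Hx; assert (Ix : Icc 0 delta x) by (unfold Icc; lra).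
    apply (derivable_pt_lim_locally_ext v _ 0 delta); [exact Hx | |].
    + intros y Hy; rewrite clamp_id; auto.
    + rewrite (clamp_id 0 delta x Ix); apply (derivable_pt_lim_of_D_in v v' 0 delta); auto.
  - intros x Hx; rewrite <- E' by (unfold Icc; lra).
    apply (derivable_pt_lim_locally_ext (fun t => dv t ^ 2 / (1 + dv t ^ 2)) _ 0 delta);
      [exact Hx | | apply Eq, Hx].
    intros y Hy; rewrite E'; auto.
Qed.

Lemma eq_of_eq_derive (u v q : R -> R) (delta : R) :
  (forall x, continuity_pt u x) -> (forall x, continuity_pt v x) ->
  (forall x, 0 < x < delta -> derivable_pt_lim u x (q x)) ->
  (forall x, 0 < x < delta -> derivable_pt_lim v x (q x)) ->
  u 0 = v 0 -> forall x, Icc 0 delta x -> u x = v x.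
Proof.
  intros Cu Cv Du Dv E0 x [[Hx | <-] Hxd]; [| exact E0].
  destruct (mean_value (fun t => u t - v t) (fun t => q t - q t) 0 x Hx) as [c [_ E]].
  - intros t _; apply (continuity_pt_minus u v); auto.
  - intros t Ht; apply (derivable_pt_lim_minus u v); [apply Du | apply Dv]; lra.
  - cbv beta in E; lra.
Qed.

(** * Existence of the slope in both cases, and conclusion *)

(** The alternative between a positive and an identically zero slope is kept in the conclusion
    because uniqueness recovers a slope from its square. *)
Lemma slope_exists (K : R -> R) (L : R) :
  0 <= L ->
  (forall x y, Icc (-1) 1 x -> Icc (-1) 1 y ->
     Rabs (K x - K y) <= L * Rabs (x - y)) ->
  0 <= K 1 ->
  exists (delta : R) (q q' : R -> R),
    0 < delta /\ q 0 = 0 /\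
    ((forall x, 0 < x <= delta -> 0 < q x) \/ (forall x, q x = 0)) /\
    (forall x, Icc 0 delta x -> D_in q q' (Icc 0 delta) x) /\
    (forall x, Icc 0 delta x -> continue_in q' (Icc 0 delta) x) /\
    (forall x, 0 < x < delta ->
       derivable_pt_lim (fun t => q t ^ 2 / (1 + q t ^ 2)) x
         (2 * x * K (1 / sqrt (1 + q x ^ 2)))).
Proof.
  intros HL0 HL [HK | HK].
  - destruct (positive_slope_exists K L HL0 HL HK)
      as [d [q [q' [Hd [q0 [Hq [Dq [Cq' Eq]]]]]]]].
    exists d, q, q'; auto 10.
  (* Zero slope has angle function 1, so the right-hand side is [2 * x * K 1 = 0]. The length 1 is
     arbitrary. *)
  - exists 1, (fun _ => 0), (fun _ => 0).
    split; [lra |]; split; [reflexivity |]; split; [auto |].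
    split; [| split].
    + intros x _; apply D_in_of_derivable_pt_lim, derivable_pt_lim_const.
    + intros x _; apply continue_in_of_continuity_pt, continuity_pt_const.
      intros ? ?; reflexivity.
    + intros x _.
      replace (1 + 0 ^ 2) with 1 by ring; rewrite sqrt_1.
      replace (1 / 1) with 1 by field; rewrite <- HK, Rmult_0_r.
      apply derivable_pt_lim_const.
Qed.

Theorem theorem2p4 :
  forall K : R -> R,
    class_C 1 (Icc (-1) 1) K ->
    0 <= K 1 ->
    exists delta : R, 0 < delta /\
      exists u : R -> R,
        nonneg_C2_solution K delta u /\
        (forall v : R -> R, nonneg_C2_solution K delta v ->
           forall x : R, Icc 0 delta x -> v x = u x).
Proof.
  intros K HK HK1.
  destruct (C1_Icc_lipschitz (-1) 1 K ltac:(lra) HK) as [L [HL0 HL]].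
  destruct (slope_exists K L HL0 HL HK1)
    as [d [q [q' [Hd [q0 [Hq [Dq [Cq' Eq]]]]]]]].
  (* The extension is continuous on the line, so its integral [u] from 0 has derivative [Q]
     everywhere, endpoints included. *)
  set (Q := fun x => q (clamp 0 d x)).
  assert (EQ : forall x, Icc 0 d x -> q x = Q x)
    by (intros x Hx; unfold Q; rewrite clamp_id; auto).
  assert (CQ : forall x, continuity_pt Q x).
  { apply continuity_pt_clamp; [lra |].
    intros x Hx; apply (cont_deriv q q'), Dq, Hx. }
  assert (Q0 : Q 0 = 0) by (rewrite <- EQ; [exact q0 | unfold Icc; lra]).
  set (u := fun x => RInt Q 0 x).
  assert (Du : forall x, derivable_pt_lim u x (Q x)).
  { intros x; apply is_derive_Reals, (is_derive_RInt Q u 0 x).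
    - apply filter_forall; intros y; apply (@RInt_correct R_CompleteNormedModule).
      apply (@ex_RInt_continuous R_CompleteNormedModule).
      intros z _; apply continuity_pt_filterlim, CQ.
    - apply continuity_pt_filterlim, CQ. }
  assert (Cu : forall x, continuity_pt u x)
    by (intros x; apply derivable_continuous_pt; exists (Q x); apply Du).
  assert (u0 : u 0 = 0) by exact (RInt_point 0 Q).
  assert (HQ : forall x, Icc 0 d x -> 0 <= Q x).
  { intros x Hx; destruct Hq as [Hq | Hq].
    - destruct Hx as [[Hx1 | <-] Hx2]; [| lra].
      rewrite <- EQ by (unfold Icc; lra); apply Rlt_le, Hq; lra.
    - unfold Q; rewrite Hq; lra. }
  assert (EqQ : forall x, 0 < x < d ->
     derivable_pt_lim (fun t => Q t ^ 2 / (1 + Q t ^ 2)) x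
       (2 * x * K (1 / sqrt (1 + Q x ^ 2)))).
  { intros x Hx; rewrite <- EQ by (unfold Icc; lra).
    apply (derivable_pt_lim_locally_ext (fun t => q t ^ 2 / (1 + q t ^ 2)) _ 0 d);
      [exact Hx | | apply Eq, Hx].
    intros y Hy; rewrite EQ; auto. }
  exists d; split; [exact Hd |]; exists u; split; [split; [| split] |].
  - exists q; split.
    + intros x Hx; apply D_in_of_derivable_pt_lim; rewrite EQ by exact Hx; apply Du.
    + exists q'; split; assumption.
  - intros x [[Hx | <-] Hxd]; [| lra].
    destruct (mean_value u Q 0 x Hx) as [c [Pc E]]; auto.
    specialize (HQ c ltac:(unfold Icc; lra)); rewrite u0 in E; nra.
  - exists Q; split; [| split; [exact EqQ | split; assumption]].
    intros x _; apply D_in_of_derivable_pt_lim, Du.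
  - intros v Hv x Hx.
    destruct (solution_slope K d v Hd Hv) as [p [Cp [p0 [Dv Eqp]]]].
    destruct Hv as [[v' [Dv' _]] [Hv [_ [_ [_ [v0 _]]]]]].
    assert (Cv : forall x, continuity_pt (fun t => v (clamp 0 d t)) x).
    { apply continuity_pt_clamp; [lra |].
      intros y Hy; apply (cont_deriv v v'), Dv', Hy. }
    assert (v0' : v (clamp 0 d 0) = 0) by (rewrite clamp_id; [exact v0 | unfold Icc; lra]).
    assert (Sq : forall y, Icc 0 d y -> Q y ^ 2 = p y ^ 2)
      by (apply (slope_sqr_unique K Q p L d); assumption).
    (* If [q > 0], then [p] cannot vanish on [(0, d]] because its square is that of [q], and
       [v >= 0] forces [p > 0]. If [q = 0], then [p ^ 2 = 0]. *)
    assert (Ep : forall y, 0 < y < d -> Q y = p y).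
    { intros y Hy; assert (Iy : Icc 0 d y) by (unfold Icc; lra).
      destruct Hq as [Hq | Hq].
      - assert (Pp : forall z, 0 < z <= d -> 0 < p z).
        { apply (slope_nonneg (fun t => v (clamp 0 d t)) p d); auto.
          - intros z Hz; apply Hv, clamp_Icc; lra.
          - intros z Hz Ez; assert (Iz : Icc 0 d z) by (unfold Icc; lra).
            specialize (Sq z Iz); rewrite <- EQ, Ez in Sq by exact Iz.
            specialize (Hq z Hz); nra. }
        specialize (Pp y ltac:(lra)); specialize (HQ y Iy); specialize (Sq y Iy); nra.
      - specialize (Sq y Iy); unfold Q in *; rewrite Hq in *; nra. }
    rewrite <- (clamp_id 0 d x Hx) at 1.
    apply (eq_of_eq_derive (fun t => v (clamp 0 d t)) u p d); auto.
    + intros y Hy; rewrite <- Ep by exact Hy; apply Du.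
    + rewrite v0', u0; reflexivity.
Qed.
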